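(* Let $\mathcal{H}$ be a complex Hilbert space, let $A\in\mathcal{B}(\mathcal{H})$ be positive semidefinite, and let $T\in\mathcal{B}_A(\mathcal{H})$. Then (i) $dw_A^2(T)\ \ge\ \max\left\{w_A^2(T)+c_A^2(|T|_A^2),\ \|T\|_A^4+c_A^2(T)\right\}$; (ii) $dw_A^2(T)\ \ge\ 2\max\left\{w_A(T)\,c_A(|T|_A^2),\ c_A(T)\,\|T\|_A^2\right\}$.
   Context: $\mathcal{B}(\mathcal{H})$ is the algebra of bounded linear operators on the complex Hilbert space $\mathcal{H}$. For a positive semidefinite $A\in\mathcal{B}(\mathcal{H})$, put $\langle x,y\rangle_A=\langle Ax,y\rangle$ and $\|x\|_A=\sqrt{\langle x,x\rangle_A}$. $\mathcal{B}_A(\mathcal{H})$ is the set of $T\in\mathcal{B}(\mathcal{H})$ admitting an $A$-adjoint, i.e. such that $AX=T^*A$ has a solution $X\in\mathcal{B}(\mathcal{H})$; then $T^{\sharp_A}$ denotes the unique solution with $\mathcal{R}(T^{\sharp_A})\subseteq\overline{\mathcal{R}(A)}$ ($\mathcal{R}$ denotes range). Every $T\in\mathcal{B}_A(\mathcal{H})$ is $A$-bounded, i.e. $\|Tx\|_A\le c\|x\|_A$ for all $x$ and some $c>0$. Write $|T|_A^2=T^{\sharp_A}T$. For $A$-bounded $T$: $\|T\|_A=\sup\{\|Tx\|_A:\|x\|_A=1\}$, $w_A(T)=\sup\{|\langle Tx,x\rangle_A|:\|x\|_A=1\}$, $c_A(T)=\inf\{|\langle Tx,x\rangle_A|:\|x\|_A=1\}$,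 and $dw_A(T)=\sup\{\sqrt{|\langle Tx,x\rangle_A|^2+\|Tx\|_A^4}:\|x\|_A=1\}$, where $x$ ranges over $\mathcal{H}$. Notation such as $dw_A^2(T)$ means $(dw_A(T))^2$. *)

(* Defs.v *)
From HB Require Import structures.
From mathcomp Require Import all_boot all_order all_algebra.
From mathcomp Require Import sesquilinear complex.
From mathcomp Require Import all_classical all_reals all_analysis.

Set Implicit Arguments.
Unset Strict Implicit.
Unset Printing Implicit Defensive.

Import Order.TTheory GRing.Theory Num.Theory.
Import numFieldNormedType.Exports.

Local Open Scope complex_scope.
Local Open Scope classical_set_scope.
Local Open Scope ring_scope.

(* Complex Hilbert spaces. [inner] is linear in its first argument,
   conjugate-linear in its second one and positive definite, and it induces
   the norm, for which the space is complete. *)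
HB.mixin Record isHilbert (R : realType) H of CompleteNormedModule R[i] H := {
  inner : {dot H for (@Num.conj R[i])} ;
  inner_norm : forall x : H, inner x x = `|x| ^+ 2
}.

#[short(type="hilbertType")]
HB.structure Definition Hilbert (R : realType) :=
  {H of CompleteNormedModule R[i] H & isHilbert R H}.

Section Operators.
Context {R : realType} {H : hilbertType R}.
Implicit Types (A T X : H -> H) (x y : H).

Definition bounded_operator : set (H -> H) :=
  [set T | linear T /\ exists M : R, forall x, `|T x| <= M%:C * `|x|].

(* The order of R[i] makes [0 <= z] mean that z is real and nonnegative. *)
Definition positive_semidefinite : set (H -> H) :=
  [set A | bounded_operator A /\ forall x, 0 <= inner (A x) x].

(* The Hilbert space adjoint of a bounded operator. Like [A_adjoint] below it
   is a definite description, whose default value (the zero operator) matters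
   only when there is no such operator. *)
Definition adjoint T : H -> H :=
  xget (fun=> 0) [set X | bounded_operator X /\
    forall x y, inner (T x) y = inner x (X y)].

Definition A_adjoint_equation A T : set (H -> H) :=
  [set X | bounded_operator X /\ A \o X = adjoint T \o A].

Definition A_adjointable A : set (H -> H) :=
  [set T | bounded_operator T /\ A_adjoint_equation A T !=set0].

Definition A_adjoint A T : H -> H :=
  xget (fun=> 0) [set X | A_adjoint_equation A T X /\
    range X `<=` closure (range A)].

Definition A_abs_sqr A T : H -> H := A_adjoint A T \o T.

Definition A_inner A x y : R[i] := inner (A x) y.

Definition A_norm A x : R := Num.sqrt (complex.Re (A_inner A x x)).

Definition A_sphere A : set H := [set x | A_norm A x = 1].

(* |<T x, x>_A|; the norm of R[i] takes its values in R[i], hence [Re]. *)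
Definition A_quad A T x : R := complex.Re `|A_inner A (T x) x|.

(* When [A_sphere A] is empty, i.e. when A = 0, the suprema and the infimum
   below are all 0. *)

Definition A_opnorm A T : R := sup [set A_norm A (T x) | x in A_sphere A].

Definition A_numradius A T : R := sup [set A_quad A T x | x in A_sphere A].

Definition A_crawford A T : R := inf [set A_quad A T x | x in A_sphere A].

Definition A_dw_radius A T : R :=
  sup [set Num.sqrt (A_quad A T x ^+ 2 + A_norm A (T x) ^+ 4) |
       x in A_sphere A].

End Operators.

(* Main.v *)
(* The inequality |<Tx,x>_A|^2 + ||Tx||_A^4 <= dw_A(T)^2 holds for every x with
   ||x||_A = 1, and ||Tx||_A^2 = <|T|_A^2 x, x>_A. Bounding one of the two terms
   from below by a Crawford number and taking the supremum of the other one
   gives (i), and (ii) follows by 2ab <= a^2 + b^2. The supremum dw_A(T) is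
   meaningful because T is A-bounded: if AX = T^*A, then S = XT is symmetric for
   <.,.>_A and <Sx,x>_A = ||Tx||_A^2, while ||S^n x||_A is log-convex in n and
   grows at most geometrically with the ordinary norm of S. That T^* exists is
   the Riesz representation theorem. *)

Require Import Defs.
From mathcomp Require Import all_boot all_order all_algebra.
From mathcomp Require Import sesquilinear complex ring lra.
From mathcomp Require Import all_classical all_reals all_analysis.

Set Implicit Arguments.
Unset Strict Implicit.
Unset Printing Implicit Defensive.

Import Order.TTheory GRing.Theory Num.Theory.
Import numFieldNormedType.Exports.
Local Open Scope complex_scope.
Local Open Scope classical_set_scope.
Local Open Scope ring_scope.

(** * Inequalities for real numbers and sequences *)

Lemma quadratic_ge0_discr (F : realFieldType) (a b c : F) :
  (forall t, 0 <= a + 2 * b * t + c * t ^+ 2) -> b ^+ 2 <= a * c.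
Proof.
move=> q0; have := q0 0; have [c0|c0] := eqVneq c 0 => qa.
- have [->|b0] := eqVneq b 0; first by rewrite c0 expr0n mulr0.
  (* For [c = 0] the polynomial is affine, and this is the point where it equals -1. *)
  have := q0 (- (a + 1) / (2 * b)).
  set t := _ / _; have -> : a + 2 * b * t + c * t ^+ 2 = -1.
    by rewrite /t c0; field.
  by rewrite ler0N1.
- have cgt0 : 0 < c.
    rewrite lt_def c0 /=; rewrite leNgt; apply/negP => clt0.
    (* For [c < 0] this point is far enough out for the quadratic term to beat the other two. *)
    have := q0 (1 + (2 * `|b| + `|a|) / - c).
    set t := _ / _.
    have ct : c * t = - (2 * `|b| + `|a|) by rewrite /t; field.
    have t0 : 0 <= t.
      by rewrite divr_ge0 ?addr_ge0 ?mulr_ge0 ?normr_ge0 // oppr_ge0 ltW.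
    have -> : c * (1 + t) ^+ 2 = c * t * (1 + t) + c * (1 + t) by ring.
    rewrite ct; have := ler_norm a; have := ler_norm b.
    have := normr_ge0 a; have := normr_ge0 b => *; nra.
  have := q0 (- b / c).
  have -> : a + 2 * b * (- b / c) + c * (- b / c) ^+ 2 = (a * c - b ^+ 2) / c.
    by field.
  by rewrite pmulr_lge0 ?invr_gt0 // subr_ge0.
Qed.

(** Log-convexity keeps every ratio of consecutive terms at least [r = u 1], so
    [r ^+ n <= u n <= K * B ^+ n]; if [B < r], this fails once [(B / r) ^+ n < K^-1]. *)
Lemma logconvex_geometric (R : realType) (u : nat -> R) (K B : R) :
  0 <= B -> u 0%N = 1 ->
  (forall n, u n.+1 ^+ 2 <= u n * u n.+2) -> (forall n, u n <= K * B ^+ n) ->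
  u 1%N <= B.
Proof.
move=> B0 u0 uu uK; rewrite leNgt; apply/negP => Bu.
set r := u 1%N in Bu; have r0 : 0 < r := le_lt_trans B0 Bu.
have ur n : 0 < u n /\ r * u n <= u n.+1.
  elim: n => [|n [un IH]]; first by rewrite u0 mulr1.
  have un1 : 0 < u n.+1 by apply: lt_le_trans IH; rewrite mulr_gt0.
  split=> //; rewrite -(ler_pM2l un); apply: le_trans (uu n).
  by rewrite mulrCA mulrA expr2 ler_wpM2r // ltW.
have ru n : r ^+ n <= u n.
  elim: n => [|n IH]; first by rewrite u0.
  by rewrite exprS; apply: le_trans (ur n).2; rewrite ler_wpM2l // ltW.
have K0 : 0 < K by have := uK 0%N; rewrite u0 mulr1 => /(lt_le_trans ltr01).
have Br : `|B / r| < 1.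
  by rewrite ger0_norm ?divr_ge0 ?(ltW r0) // ltr_pdivrMr // mul1r.
have Ki : 0 < K^-1 by rewrite invr_gt0.
have [N _ /(_ N (leqnn N))/=] := cvgr0_norm_lt _ (cvg_expr Br) _ Ki.
rewrite ger0_norm ?exprn_ge0 ?divr_ge0 ?(ltW r0) // expr_div_n.
rewrite ltr_pdivrMr ?exprn_gt0 // mulrC ltr_pdivlMr // mulrC.
by rewrite ltNge (le_trans (ru N) (uK N)).
Qed.

(** Gives both halves of (i), with exponents 2 and 4 on the supremum. Writing the exponent as [k.+1]
    keeps it positive, so that roots can be taken and the empty case gives 0. *)
Lemma sup_inf_sqr_le (R : realType) (I : Type) (S : set I) (p q : I -> R)
    (D : R) (k : nat) :
  (forall x, S x -> 0 <= p x) -> (forall x, S x -> 0 <= q x) ->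
  (forall x, S x -> p x ^+ k.+1 + q x ^+ 2 <= D) -> 0 <= D ->
  sup (p @` S) ^+ k.+1 + inf (q @` S) ^+ 2 <= D.
Proof.
move=> p0 q0 pqD D0; have [->|/set0P[x0 Sx0]] := eqVneq S set0.
  by rewrite !image_set0 sup0 inf0 !expr0n /= addr0.
have inf_ge0 : 0 <= inf (q @` S).
  by apply: lb_le_inf; [exists (q x0), x0|move=> _ [x Sx <-]; exact: q0].
have infq x : S x -> inf (q @` S) <= q x.
  move=> Sx; apply: ge_inf; last by exists x.
  by exists 0 => _ [y Sy <-]; exact: q0.
have pD x : S x -> p x ^+ k.+1 <= D - inf (q @` S) ^+ 2.
  move=> Sx; rewrite lerBrDr; apply: le_trans (pqD x Sx); rewrite lerD2l.
  by rewrite ler_pXn2r ?nnegrE ?infq ?q0.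
set E := D - _ in pD.
have E0 : 0 <= E by apply: le_trans (pD _ Sx0); rewrite exprn_ge0 ?p0.
(* The root of [E] bounds [p] itself, which brings the supremum inside the power. *)
pose r := E `^ k.+1%:R^-1.
have rE : r ^+ k.+1 = E.
  by rewrite -powR_mulrn ?powR_ge0 // -powRrM mulVf // powRr1.
have p_ub : ubound (p @` S) r.
  move=> _ [x Sx <-].
  by rewrite -(ler_pXn2r (n := k.+1)) ?nnegrE ?powR_ge0 ?p0 // rE pD.
rewrite -lerBrDr -/E -rE ler_pXn2r ?nnegrE ?powR_ge0 //.
  by apply: ge_sup => //; exists (p x0), x0.
by apply: le_trans (p0 _ Sx0) _; apply: ub_le_sup; [exists r|exists x0].
Qed.

(** * Real positive semidefinite forms and Cauchy-Schwarz *)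

Section RealForm.
Context {R : realType} {U : lmodType R[i]}.

(** Definiteness is left out so that the real parts of both [inner] and [A_inner A] are
    instances. *)
Record real_psd_form (b : U -> U -> R) : Prop := RealPsdForm {
  psd_formC : forall x y, b x y = b y x ;
  psd_formDl : forall x y z, b (x + y) z = b x z + b y z ;
  psd_formZl : forall (t : R) x y, b (t%:C *: x) y = t * b x y ;
  psd_form_ge0 : forall x, 0 <= b x x
}.

Context {b : U -> U -> R} (bP : real_psd_form b).

Lemma psd_formDr x y z : b x (y + z) = b x y + b x z.
Proof. by rewrite !(psd_formC bP x) psd_formDl. Qed.

Lemma psd_formZr (t : R) x y : b x (t%:C *: y) = t * b x y.
Proof. by rewrite !(psd_formC bP x) psd_formZl. Qed.

Lemma psd_formBl x y z : b (x - y) z = b x z - b y z.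
Proof.
rewrite -scaleN1r psd_formDl // -[-1](rmorphN1 (real_complex R)).
by rewrite psd_formZl // mulN1r.
Qed.

Lemma psd_form_quad x y t :
  b (x + t%:C *: y) (x + t%:C *: y) = b x x + 2 * b x y * t + b y y * t ^+ 2.
Proof.
rewrite !(psd_formDl bP, psd_formDr, psd_formZl bP, psd_formZr).
by rewrite (psd_formC bP y x); ring.
Qed.

Lemma psd_form_CauchySchwarz x y : b x y ^+ 2 <= b x x * b y y.
Proof.
by apply: quadratic_ge0_discr => t; rewrite -psd_form_quad psd_form_ge0.
Qed.

End RealForm.

(** * Real and imaginary parts of the inner product; Riesz representation *)

Section Hilbert.
Context {R : realType} {H : hilbertType R}.
Implicit Types (A T X : H -> H) (x y z : H).

Definition re_inner x y : R := complex.Re (inner x y).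
Definition re_norm x : R := complex.Re `|x|.

Lemma ReD (a b : R[i]) : complex.Re (a + b) = complex.Re a + complex.Re b.
Proof. by case: a; case: b. Qed.

Lemma ImD (a b : R[i]) : complex.Im (a + b) = complex.Im a + complex.Im b.
Proof. by case: a; case: b. Qed.

Lemma innerC x y : inner x y = (inner y x)^*%C.
Proof. by rewrite hermC expr0 mul1r. Qed.

Lemma innerDl x y z : inner (x + y) z = inner x z + inner y z.
Proof. by rewrite linearDl. Qed.

Lemma innerDr x y z : inner x (y + z) = inner x y + inner x z.
Proof. by rewrite linearDr. Qed.

Lemma innerZl (a : R[i]) x y : inner (a *: x) y = a * inner x y.
Proof. by rewrite linearZl_LR. Qed.

Lemma innerZr (a : R[i]) x y : inner x (a *: y) = a^*%C * inner x y.
Proof. by rewrite linearZr_LR. Qed.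

Lemma re_normE x : `|x| = (re_norm x)%:C.
Proof. by rewrite /re_norm RRe_real // ger0_real. Qed.

Lemma re_norm_ge0 x : 0 <= re_norm x.
Proof. by rewrite -ler0c -re_normE. Qed.

Lemma re_inner_norm x : re_inner x x = re_norm x ^+ 2.
Proof. by rewrite /re_inner inner_norm re_normE -rmorphXn. Qed.

Lemma re_inner_psd : real_psd_form re_inner.
Proof.
split=> [x y|x y z|t x y|x].
- by rewrite /re_inner innerC; case: (inner y x).
- by rewrite /re_inner innerDl ReD.
- rewrite /re_inner innerZl.
  by case: (inner x y) => a b /=; rewrite mul0r subr0.
- by rewrite re_inner_norm sqr_ge0.
Qed.

Lemma re_inner_le x y : `|re_inner x y| <= re_norm x * re_norm y.
Proof.
rewrite -(ler_pXn2r (n := 2)) ?nnegrE ?mulr_ge0 ?re_norm_ge0 //.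
rewrite real_normK ?num_real // exprMn -!re_inner_norm.
exact: psd_form_CauchySchwarz re_inner_psd _ _.
Qed.

(** Rotating by ['i] recovers the imaginary part from [re_inner], so complex identities reduce to
    real ones. *)
Lemma Im_innerE x y : complex.Im (inner x y) = - re_inner ('i%C *: x) y.
Proof.
rewrite /re_inner innerZl; case: (inner x y) => a b /=.
by rewrite mul0r mul1r sub0r opprK.
Qed.

Lemma innerP x y x' y' :
  re_inner x y = re_inner x' y' ->
  re_inner ('i%C *: x) y = re_inner ('i%C *: x') y' ->
  inner x y = inner x' y'.
Proof.
move=> e1 e2; apply/eqP; rewrite eq_complex !Im_innerE e2 eqxx andbT.
exact/eqP.
Qed.

Lemma inner_injr y y' : (forall x, inner x y = inner x y') -> y = y'.
Proof.
move=> e; apply/eqP; rewrite -subr_eq0 -normr_eq0 -sqrf_eq0 -inner_norm.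
rewrite innerDr -scaleN1r innerZr e -innerZr -innerDr scaleN1r subrr.
by rewrite -(scale0r 0) innerZr conjc0 mul0r.
Qed.

(* The representing vector minimises [|x|^2 - 2 f x]; by the parallelogram law
   a minimising sequence is Cauchy. *)
Lemma real_riesz (f : H -> R) (M : R) :
  (forall x y, f (x + y) = f x + f y) ->
  (forall (t : R) x, f (t%:C *: x) = t * f x) ->
  (forall x, f x <= M * re_norm x) ->
  exists z, forall x, f x = re_inner z x.
Proof.
move=> fD fZ fM; pose J x := re_inner x x - 2 * f x.
have bP := re_inner_psd.
(* Completing the square: [J x] is at least [(re_norm x - M) ^+ 2 - M ^+ 2]. *)
have Jlb : lbound (range J) (- M ^+ 2).
  move=> _ [x _ <-]; rewrite /J re_inner_norm.
  have := fM x; have := sqr_ge0 (re_norm x - M); nra.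
have Jinf : has_inf (range J) by split; [exists (J 0), 0|exists (- M ^+ 2)].
pose m := inf (range J).
have mJ x : m <= J x by apply: ge_inf; [case: Jinf|exists x].
have Ju n : exists x, J x < m + n.+1%:R^-1.
  have n0 : 0 < n.+1%:R^-1 :> R by rewrite invr_gt0.
  by have [_ [x _ <-] ?] := inf_adherent n0 Jinf; exists x.
have [u uJ] := choice Ju.
pose mid x y := (2^-1 : R)%:C *: (x + y).
(* The linear parts of [J] cancel at the midpoint, leaving the parallelogram law. *)
have par x y : re_norm (x - y) ^+ 2 = 2 * (J x + J y - 2 * J (mid x y)).
  rewrite -re_inner_norm /J /mid fZ fD (psd_formZl bP) (psd_formZr bP).
  rewrite (psd_formBl bP) -[- y]scaleN1r -[-1](rmorphN1 (real_complex R)).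
  rewrite !(psd_formDr bP) !(psd_formDl bP) !(psd_formZr bP) (psd_formC bP y x).
  by field.
have u_cauchy : cauchy (u @ \oo).
  apply: cauchy_exP => e; rewrite ltcE => /andP[/eqP/= Ime Ree].
  have eE : e = (complex.Re e)%:C by case: e Ime {Ree} => a b /= ->.
  (* By [par] and [m <= J (mid _ _)], the squared distance is below twice the sum of the two
     excesses over [m], hence the factor 4. *)
  have d0 : 0 < complex.Re e ^+ 2 / 4 by rewrite divr_gt0 ?exprn_gt0.
  have [N _ NP] : \forall n \near \oo, n.+1%:R^-1 < complex.Re e ^+ 2 / 4 :> R.
    exact: near_infty_natSinv_lt (PosNum d0).
  exists (u N), N => // n /= Nn.
  rewrite -ball_normE /= eE re_normE ltcR.
  rewrite -(ltr_pXn2r (n := 2)) ?nnegrE ?re_norm_ge0 ?(ltW Ree) // par.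
  move: (NP N (leqnn N)) (NP n Nn) (uJ n) (uJ N) (mJ (mid (u N) (u n))) => /=.
  move: (J _) (J _) (J _) (n.+1%:R^-1) (N.+1%:R^-1) (complex.Re e ^+ 2) => *.
  lra.
have /cauchy_cvgP/cvg_ex[/= z uz] := u_cauchy.
exists z => h.
(* Moving from [u n] along [h] lowers [J] by at most [n.+1%:R^-1]; the discriminant of this
   quadratic in [t] bounds the first variation. *)
have uh n : (f h - re_inner (u n) h) ^+ 2 <= n.+1%:R^-1 * re_norm h ^+ 2.
  rewrite -re_inner_norm; apply: quadratic_ge0_discr => t.
  move: (mJ (u n + (- t)%:C *: h)) (uJ n); rewrite /J psd_form_quad // fD fZ.
  by move: (n.+1%:R^-1) => e; lra.
apply/eqP; rewrite -subr_eq0 -normr_le0; apply/ler_addgt0Pl => e e0.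
rewrite addr0.
(* Two errors of size at most [d * re_norm h] will add up to at most [e]; the 1 covers [h = 0]. *)
pose d := e / (2 * (1 + re_norm h)).
have h0 := re_norm_ge0 h.
have d0 : 0 < d by rewrite divr_gt0 // mulr_gt0 // ltr_pwDl.
have eE : e = 2 * (d * re_norm h) + 2 * d.
  by rewrite /d; field; rewrite gt_eqF // ltr_pwDl.
move: d d0 eE => d d0 eE.
have d20 : 0 < d ^+ 2 by rewrite exprn_gt0.
have dC0 : 0 < d%:C by rewrite ltcR.
have : \forall n \near \oo, `|z - u n| < d%:C /\ n.+1%:R^-1 < d ^+ 2.
  apply: filterI; last exact: near_infty_natSinv_lt (PosNum d20).
  by have /cvgr_dist_lt := uz; apply.
case=> N _ /(_ N (leqnn N)) [/= zN dN].
rewrite re_normE ltcR in zN.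
have -> : f h - re_inner z h = (f h - re_inner (u N) h) - re_inner (z - u N) h.
  by rewrite (psd_formBl bP); ring.
apply: le_trans (ler_normB _ _) _.
have := re_inner_le (z - u N) h.
have : `|f h - re_inner (u N) h| <= d * re_norm h.
  rewrite -(ler_pXn2r (n := 2)) ?nnegrE ?mulr_ge0 ?(ltW d0) //.
  rewrite real_normK ?num_real // exprMn.
  by apply: le_trans (uh N) _; rewrite ler_wpM2r ?sqr_ge0 // ltW.
have : re_norm (z - u N) * re_norm h <= d * re_norm h.
  by rewrite ler_wpM2r // ltW.
lra.
Qed.

(** * Bounded operators and existence of the adjoint *)

Lemma bounded_operatorD T x y : bounded_operator T -> T (x + y) = T x + T y.
Proof. by case=> lT _; have := lT 1 x y; rewrite !scale1r. Qed.

Lemma bounded_operatorZ T a x : bounded_operator T -> T (a *: x) = a *: T x.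
Proof.
move=> bT; have T0 : T 0 = 0.
  by apply: (addrI (T 0)); rewrite -bounded_operatorD // !addr0.
by case: bT => lT _; have := lT a x 0; rewrite !addr0 T0 addr0.
Qed.

Lemma bounded_operator_bound T : bounded_operator T ->
  exists2 M : R, 0 <= M & forall x, re_norm (T x) <= M * re_norm x.
Proof.
move=> [_ [M TM]]; exists `|M| => // x.
apply: (@le_trans _ _ (M * re_norm x)).
  by rewrite -lecR rmorphM /= -!re_normE.
by rewrite ler_wpM2r ?re_norm_ge0 ?ler_norm.
Qed.

(** Riesz represents [re_inner (T x) y], as a functional of [x], by a vector [X y]; linearity of [X]
    follows from uniqueness of the representing vector. *)
Lemma adjoint_exists T : bounded_operator T ->
  exists X, bounded_operator X /\ forall x y, inner (T x) y = inner x (X y).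
Proof.
move=> bT; have [M M0 TM] := bounded_operator_bound bT.
have bP := re_inner_psd.
have /choice[X XP] y : exists z, forall x, re_inner (T x) y = re_inner z x.
  apply: (real_riesz (M := M * re_norm y)) => [u v|t u|u].
  - by rewrite bounded_operatorD // (psd_formDl bP).
  - by rewrite bounded_operatorZ // (psd_formZl bP).
  - apply: le_trans (ler_norm _) _; apply: le_trans (re_inner_le _ _) _.
    by rewrite mulrAC ler_wpM2r ?re_norm_ge0.
have adjX x y : inner (T x) y = inner x (X y).
  apply: innerP; first by rewrite XP (psd_formC bP).
  by rewrite -(bounded_operatorZ _ _ bT) XP (psd_formC bP).
exists X; split=> //; split.
  move=> a u v; apply: inner_injr => x.
  by rewrite innerDr innerZr -!adjX -innerZr -innerDr.
exists M => y; rewrite !re_normE -rmorphM lecR.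
have := re_norm_ge0 (X y); rewrite le_eqVlt => /predU1P[<-|X0].
  by rewrite mulr_ge0 ?re_norm_ge0.
(* The squared norm of [X y] is [re_inner (T (X y)) y], so one factor of the norm cancels. *)
rewrite -(ler_pM2l X0) -expr2 -re_inner_norm -XP.
apply: le_trans (ler_norm _) _; apply: le_trans (re_inner_le _ _) _.
by rewrite mulrA [_ * M]mulrC ler_wpM2r ?re_norm_ge0.
Qed.

Lemma adjointP T x y : bounded_operator T ->
  inner (T x) y = inner x (adjoint T y).
Proof. by move=> /adjoint_exists /(xgetPex (fun=> 0)) []. Qed.

(** * The form of [A] and boundedness with respect to it *)

Definition re_A_inner A x y : R := complex.Re (A_inner A x y).

(** Symmetry comes from polarisation: reality of the quadratic form at [x + y] makes the imaginary
    part antisymmetric, and replacing [x] by ['i *: x] turns this into symmetry of the real part. *)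
Lemma re_A_inner_psd A : positive_semidefinite A ->
  real_psd_form (re_A_inner A).
Proof.
move=> [bA A0]; rewrite /re_A_inner /A_inner.
have ImA x y : complex.Im (inner (A x) y) = - complex.Im (inner (A y) x).
  have := ger0_Im (A0 (x + y)).
  rewrite bounded_operatorD // innerDl !innerDr !ImD.
  rewrite (ger0_Im (A0 x)) (ger0_Im (A0 y)) add0r addr0 => /eqP.
  by rewrite addr_eq0 => /eqP.
split=> [x y|x y z|t x y|x].
- have := ImA ('i%C *: x) y; rewrite bounded_operatorZ // innerZl innerZr.
  case: (inner (A x) y) (inner (A y) x) => [a b] [c d] /=.
  by rewrite !mul0r mul1r add0r; lra.
- by rewrite bounded_operatorD // innerDl ReD.
- rewrite bounded_operatorZ // innerZl.
  by case: (inner (A x) y) => a b /=; rewrite mul0r subr0.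
- by have := A0 x; rewrite lecE => /andP[].
Qed.

Lemma A_norm_sqr A x : positive_semidefinite A ->
  A_norm A x ^+ 2 = re_A_inner A x x.
Proof.
by move=> pA; rewrite sqr_sqrtr // (psd_form_ge0 (re_A_inner_psd pA)).
Qed.

Lemma A_adjoint_inner A T X x y :
  bounded_operator T -> A_adjoint_equation A T X ->
  A_inner A (X x) y = A_inner A x (T y).
Proof.
move=> bT [_ AX]; rewrite /A_inner.
have -> : A (X x) = adjoint T (A x) by rewrite -[LHS]/((A \o X) x) AX.
by rewrite innerC -adjointP // -innerC.
Qed.

(* Krein's trick: [|S^n x|_A^2] is log-convex in [n] and grows at most like the
   powers of the squared ordinary bound of [S]. *)
Lemma A_symmetric_bounded A S (M : R) x : positive_semidefinite A ->
  (forall y z, re_A_inner A (S y) z = re_A_inner A y (S z)) ->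
  0 <= M -> (forall y, re_norm (S y) <= M * re_norm y) ->
  re_A_inner A x x = 1 -> re_A_inner A (S x) (S x) <= M ^+ 2.
Proof.
move=> pA Ssym M0 SM x1; have aP := re_A_inner_psd pA.
have [L L0 AL] := bounded_operator_bound pA.1.
have SnM n : re_norm (iter n S x) <= M ^+ n * re_norm x.
  elim: n => [|n IH] /=; first by rewrite mul1r.
  by apply: le_trans (SM _) _; rewrite exprS -mulrA ler_wpM2l.
pose u n := re_A_inner A (iter n S x) (iter n S x).
apply: (@logconvex_geometric R u (L * re_norm x ^+ 2)) => // [|n|n].
- exact: sqr_ge0.
(* Symmetry shifts one [S] across, so [u n.+1] pairs the iterates [n] and [n.+2]. *)
- rewrite {1}/u -Ssym /= (psd_formC aP); exact: psd_form_CauchySchwarz.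
- apply: le_trans (ler_norm _) _; apply: le_trans (re_inner_le _ _) _.
  apply: le_trans (ler_wpM2r (re_norm_ge0 _) (AL _)) _.
  rewrite -!mulrA ler_wpM2l // -expr2 -exprM mulnC exprM.
  rewrite mulrA -[re_norm x * re_norm x]expr2 -exprMn mulrC.
  by rewrite ler_pXn2r ?nnegrE ?mulr_ge0 ?exprn_ge0 ?re_norm_ge0.
Qed.

Lemma A_sphereP A x : positive_semidefinite A ->
  A_sphere A x -> re_A_inner A x x = 1.
Proof. by move=> pA x1; rewrite -A_norm_sqr // x1 expr1n. Qed.

Lemma A_adjointable_bounded A T :
  positive_semidefinite A -> A_adjointable A T ->
  exists B : R, forall x, A_sphere A x -> A_norm A (T x) ^+ 4 <= B.
Proof.
move=> pA [bT [X XP]]; have aP := re_A_inner_psd pA.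
have [M1 M10 TM] := bounded_operator_bound bT.
have [M2 M20 XM] := bounded_operator_bound XP.1.
exists ((M2 * M1) ^+ 2) => x /(A_sphereP pA) x1.
have XT y z : re_A_inner A (X (T y)) z = re_A_inner A (T y) (T z).
  by rewrite /re_A_inner (A_adjoint_inner _ _ bT XP).
have -> : A_norm A (T x) ^+ 4 = re_A_inner A (X (T x)) x ^+ 2.
  by rewrite (exprM _ 2 2) A_norm_sqr // XT.
(* It remains to bound the squared A-seminorm of [X (T x)], and [X \o T] is symmetric for the
   form. *)
apply: le_trans (psd_form_CauchySchwarz aP _ _) _; rewrite x1 mulr1.
apply: (@A_symmetric_bounded A (X \o T)) => // [y z||y].
- by rewrite /= XT [RHS](psd_formC aP) XT (psd_formC aP).
- exact: mulr_ge0.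
- by apply: le_trans (XM _) _; rewrite -mulrA ler_wpM2l.
Qed.

Lemma A_quad_sqr A T x : A_quad A T x ^+ 2 =
  complex.Re (A_inner A (T x) x) ^+ 2 + complex.Im (A_inner A (T x) x) ^+ 2.
Proof.
rewrite /A_quad normc_def /= sqr_sqrtr //; apply: addr_ge0; exact: sqr_ge0.
Qed.

Lemma A_quad_ge0 A T x : 0 <= A_quad A T x.
Proof. by rewrite /A_quad normc_def /= sqrtr_ge0. Qed.

(** Real and imaginary parts are bounded separately by real Cauchy-Schwarz, hence the factor 2. The
    bound serves to show that the supremum [A_dw_radius A T] is finite. *)
Lemma A_quad_le A T x : positive_semidefinite A -> A_sphere A x ->
  A_quad A T x ^+ 2 <= 2 * A_norm A (T x) ^+ 2.
Proof.
move=> pA /(A_sphereP pA) x1; have aP := re_A_inner_psd pA.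
have iE y : re_A_inner A ('i%C *: y) ('i%C *: y) = re_A_inner A y y.
  rewrite /re_A_inner /A_inner (bounded_operatorZ _ _ pA.1) innerZl innerZr.
  by case: (inner (A y) y) => a b /=; ring.
have ImE : complex.Im (A_inner A (T x) x) = - re_A_inner A ('i%C *: T x) x.
  by rewrite Im_innerE /re_A_inner /A_inner (bounded_operatorZ _ _ pA.1).
have := psd_form_CauchySchwarz aP (T x) x.
have := psd_form_CauchySchwarz aP ('i%C *: T x) x.
rewrite iE x1 A_quad_sqr ImE sqrrN A_norm_sqr // -/(re_A_inner A (T x) x); lra.
Qed.

Lemma A_quad_abs_sqr_le A T x : positive_semidefinite A -> bounded_operator T ->
  A_quad A (A_abs_sqr A T) x <= A_norm A (T x) ^+ 2.
Proof.
move=> pA bT; rewrite A_norm_sqr // /A_quad /A_abs_sqr compE /A_adjoint.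
(* When the description of the A-adjoint is empty, A_abs_sqr is zero and the
   bound is trivial. *)
case: xgetP => [X _ [XP _]|_].
  rewrite (A_adjoint_inner _ _ bT XP) ger0_norm //; exact: pA.2.
rewrite /A_inner -(scale0r 0) (bounded_operatorZ _ _ pA.1) innerZl mul0r normr0.
exact: (psd_form_ge0 (re_A_inner_psd pA)).
Qed.

End Hilbert.

Theorem theorem2p6 (R : realType) (H : hilbertType R) (A T : H -> H)
    (A_psd : positive_semidefinite A) (T_BA : A_adjointable A T) :
  A_dw_radius A T ^+ 2 >=
    Num.max (A_numradius A T ^+ 2 + A_crawford A (A_abs_sqr A T) ^+ 2)
            (A_opnorm A T ^+ 4 + A_crawford A T ^+ 2)
  /\
  A_dw_radius A T ^+ 2 >=
    2 * Num.max (A_numradius A T * A_crawford A (A_abs_sqr A T))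
                (A_crawford A T * A_opnorm A T ^+ 2).
Proof.
have q0 T' x := A_quad_ge0 A T' x.
have n0 x : 0 <= A_norm A x by exact: sqrtr_ge0.
have [B TB] := A_adjointable_bounded A_psd T_BA.
pose dw x := A_quad A T x ^+ 2 + A_norm A (T x) ^+ 4.
have dw0 x : 0 <= dw x by rewrite addr_ge0 ?exprn_ge0.
have dw_le x : A_sphere A x -> dw x <= A_dw_radius A T ^+ 2.
  move=> x1.
  have dw_sup : Num.sqrt (dw x) <= A_dw_radius A T.
    have dw_ub : has_ubound [set Num.sqrt (dw x) | x in A_sphere A].
      (* With [s = A_norm A (T y) ^+ 2], the first term of [dw y] is at most [2 * s <= 1 + s ^+ 2],
         and [s ^+ 2 <= B]. *)
      exists (Num.sqrt (2 * (1 + B) + B)) => _ [y y1 <-]; rewrite ler_wsqrtr //.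
      have := A_quad_le T A_psd y1; have := TB y y1; rewrite /dw (exprM _ 2 2).
      by have := sqr_ge0 (A_norm A (T y) ^+ 2 - 1); nra.
    by apply: (ub_le_sup dw_ub); exists x.
  rewrite -[leLHS]sqr_sqrtr // ler_pXn2r ?nnegrE ?sqrtr_ge0 //.
  exact: le_trans dw_sup.
have P1 : A_numradius A T ^+ 2 + A_crawford A (A_abs_sqr A T) ^+ 2 <=
    A_dw_radius A T ^+ 2.
  apply: sup_inf_sqr_le => // [x x1|]; last exact: sqr_ge0.
  apply: le_trans (dw_le x x1); rewrite lerD2l (exprM _ 2 2).
  by rewrite ler_pXn2r ?nnegrE ?exprn_ge0 // A_quad_abs_sqr_le //; case: T_BA.
have P2 : A_opnorm A T ^+ 4 + A_crawford A T ^+ 2 <= A_dw_radius A T ^+ 2.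
  (* The roles are exchanged: the supremum is over [A_norm A (T x)], with [k = 3], and the infimum
     over [A_quad A T x]. *)
  apply: sup_inf_sqr_le => // [x x1|]; last exact: sqr_ge0.
  by rewrite addrC; exact: dw_le.
split; first by rewrite ge_max P1.
rewrite maxr_pMr // ge_max; apply/andP; split.
- by have := sqr_ge0 (A_numradius A T - A_crawford A (A_abs_sqr A T)); nra.
- have := sqr_ge0 (A_opnorm A T ^+ 2 - A_crawford A T).
  by move: P2; rewrite (exprM _ 2 2); nra.
Qed.
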